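(* Suppose every block $b$ satisfies the initial cover-slack condition $H_b-\mathrm{mc}(f_b)>2K$. Then P-BDQ-UCB satisfies every group floor in every block, pathwise and deterministically: each pull lowers $\mathrm{mc}$ of the remaining deficits by at most one, so in each block the guard fires at a round $\tau_c$ no later than the round with $r=2K$ and at a state with $S(\tau_c)>2K-1$, where the rounded minimum cover $\lceil w(\tau_c)\rceil$ has size $\sum_i\lceil w_i(\tau_c)\rceil\le\mathrm{mc}(d(\tau_c))+K\le r(\tau_c)-K+1$ and fits in the remaining budget.
   Context: Setting: $K$ arms with $[0,1]$-valued independent rewards; horizon $T$ split into consecutive blocks, block $b$ of length $H_b$; a collection $\mathcal G$ of nonempty, possibly overlapping subsets of $[K]$ (groups); integer floors $f_b=(f_{b,g})_{g\in\mathcal G}$, $f_{b,g}\ge0$, requiring at least $f_{b,g}$ pulls of arms of $g$ inside block $b$. Notation. At a round $\tau$ of block $b$: $r(\tau)$ is the number of rounds remaining in the block (including $\tau$), $d_g(\tau)=\max\{f_{b,g}-\#\{\text{pulls of arms of }g\text{ so far in the block}\},0\}$. For $d\ge0$, $\mathrm{mc}(d)=\min\{\sum_iy_i:y\ge0,\ \sum_{i\in g}y_i\ge d_g\ \forall g\in\mathcal G\}$, and $S(\tau)=r(\tau)-\mathrm{mc}(d(\tau))$. With $L=\log(2KT/\eta)$, $\eta\in(0,1)$: $U_i(\tau)=\min\{1,\widehat\mu_i+\sqrt{2L/(N_i\vee1)}\}$, where $N_i,\widehat\mu_i$ are the pull count and empirical mean of arm $i$ over all observations so far. P-BDQ-UCB.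 In each block: at the first round $\tau_c$ with $S(\tau_c)\le2K$ (the guard fires, at most once per block), commit to the lexicographically first minimum fractional cover $w(\tau_c)$ attaining $\mathrm{mc}(d(\tau_c))$, pull each arm $i$ exactly $\lceil w_i(\tau_c)\rceil$ times over the following rounds, and spend any leftover rounds of the block on an arm with maximal index. At every earlier round, compute the lexicographically first extreme-point solution $\widehat y(\tau)$ of $\max\{\sum_iU_i(\tau)y_i:y\ge0,\ \sum_{i\in g}y_i\ge d_g(\tau)\ \forall g,\ \sum_iy_i=r(\tau)\}$ and draw the pulled arm from the distribution $\widehat y(\tau)/r(\tau)$. *)

(* Defs.v *)
From HB Require Import structures.
From mathcomp Require Import all_boot all_order all_algebra.
From mathcomp Require Import all_classical all_reals all_analysis.

Set Implicit Arguments.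
Unset Strict Implicit.
Unset Printing Implicit Defensive.

Import Order.TTheory GRing.Theory Num.Theory.

Local Open Scope classical_set_scope.
Local Open Scope ring_scope.

Section LinearPrograms.
Variables (R : realType) (K : nat) (G : {set {set 'I_K}}).
Implicit Types (d : {set 'I_K} -> R) (y z : 'rV[R]_K) (P : set 'rV[R]_K).

Definition total y : R := \sum_(i < K) y 0 i.

Definition fractional_cover d : set 'rV[R]_K :=
  [set y | (forall i, 0 <= y 0 i) /\
           (forall g, g \in G -> d g <= \sum_(i in g) y 0 i)].

(* The infimum is attained: the groups in G are nonempty, so the program is
   feasible, and its objective is bounded below by 0. *)
Definition mc d : R := inf (total @` fractional_cover d).

Definition minimum_cover d : set 'rV[R]_K :=
  [set y | fractional_cover d y /\ total y = mc d].

Definition lex_le y z : bool :=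
  Order.le ([tuple y 0 i | i < K] : K.-tuplelexi R) [tuple z 0 i | i < K].

(* The lexicographically smallest element of P; 0 if there is none. *)
Definition lex_first P : 'rV[R]_K :=
  xget 0 [set y | P y /\ forall z, P z -> lex_le y z].

Definition extreme_point P y : Prop :=
  P y /\ forall u v (t : R), P u -> P v -> 0 < t < 1 ->
    y = t *: u + (1 - t) *: v -> u = y /\ v = y.

Definition plan_polytope d (r : nat) : set 'rV[R]_K :=
  [set y | fractional_cover d y /\ total y = r%:R].

Definition extreme_optimal_plan (U : 'I_K -> R) d (r : nat) : set 'rV[R]_K :=
  [set y | extreme_point (plan_polytope d r) y /\
           forall z, plan_polytope d r z ->
             \sum_(i < K) U i * z 0 i <= \sum_(i < K) U i * y 0 i].

End LinearPrograms.

(* Rounds are numbered globally from 0.  Block b has length H b, and position h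
   of block b, for h < H b, is the global round block_start b + h; it is reached
   after h pulls in the block.  Only the blocks b < B exist.  A t is the arm
   pulled at round t and X t i is the reward that arm i would yield at round t,
   so that the learner observes X t (A t). *)
Section Protocol.
Variables (R : realType) (K B : nat) (H : nat -> nat).
Variables (G : {set {set 'I_K}}) (f : nat -> {set 'I_K} -> nat) (eta : R).
Variables (A : nat -> 'I_K) (X : nat -> 'I_K -> R).

Definition block_start (b : nat) : nat := (\sum_(c < b) H c)%N.

Definition horizon : nat := block_start B.

Definition arm_at (b h : nat) : 'I_K := A (block_start b + h)%N.

Definition group_pulls (b h : nat) (g : {set 'I_K}) : nat :=
  (\sum_(j < h) (arm_at b j \in g))%N.

(* Truncated subtraction on nat provides the maximum with 0. *)
Definition deficit (b h : nat) (g : {set 'I_K}) : R :=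
  (f b g - group_pulls b h g)%N%:R.

Definition remaining (b h : nat) : nat := (H b - h)%N.

Definition slack (b h : nat) : R :=
  (remaining b h)%:R - mc G (deficit b h).

Definition guard_fires_at (b c : nat) : Prop :=
  [/\ (c < H b)%N, slack b c <= (2 * K)%:R &
      forall h, (h < c)%N -> (2 * K)%:R < slack b h].

Definition pull_count (t : nat) (i : 'I_K) : nat :=
  (\sum_(s < t) (A s == i))%N.

(* Equal to 0 for an arm without observations; any convention in [0, 1] gives
   such an arm the index 1. *)
Definition empirical_mean (t : nat) (i : 'I_K) : R :=
  (\sum_(s < t | A s == i) X s i) / (pull_count t i)%:R.

Definition log_term : R := ln ((2 * K * horizon)%:R / eta).

Definition ucb_index (t : nat) (i : 'I_K) : R :=
  Num.min 1 (empirical_mean t i +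
             Num.sqrt (2 * log_term / (maxn (pull_count t i) 1)%:R)).

Definition plan (b h : nat) : 'rV[R]_K :=
  lex_first (extreme_optimal_plan G (ucb_index (block_start b + h))
                                  (deficit b h) (remaining b h)).

Definition draw_probability (b h : nat) (i : 'I_K) : R :=
  plan b h 0 i / (remaining b h)%:R.

Definition committed_cover (b c : nat) : 'rV[R]_K :=
  lex_first (minimum_cover G (deficit b c)).

Definition rounded_cover (b c : nat) (i : 'I_K) : int :=
  Num.ceil (committed_cover b c 0 i).

(* At position h of a block whose guard fired at position c, the pulls of arm i
   made since the commitment do not yet exhaust its rounded cover. *)
Definition owed (b c h : nat) (i : 'I_K) : bool :=
  ((\sum_(c <= j < h) (arm_at b j == i))%N%:Z < rounded_cover b c i)%R.

(* The sample paths of the algorithm.  Before the guard fires, a path may take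
   any arm to which the draw gives positive probability.  From the firing round
   on, the rounded cover is played first, in any order, and then arms of maximal
   current index with ties broken arbitrarily. *)
Definition pbdq_ucb_path : Prop :=
  forall b h, (b < B)%N -> (h < H b)%N ->
    ((forall c, (c <= h)%N -> (2 * K)%:R < slack b c) ->
       0 < draw_probability b h (arm_at b h)) /\
    (forall c, (c <= h)%N -> guard_fires_at b c ->
       ((exists i, owed b c h i) -> owed b c h (arm_at b h)) /\
       (~ (exists i, owed b c h i) ->
          forall i, ucb_index (block_start b + h) i
                      <= ucb_index (block_start b + h) (arm_at b h))).

End Protocol.

(* Main.v *)
(** Adding one unit of the pulled arm to a cover of the later deficits covers
    the earlier ones, so a pull lowers [mc] by at most one, and the deficits
    never increase; hence the slack drops by at most one per round.
    It starts above [2K] and is at most the number of remaining rounds, so the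
    guard fires no later than the round with [2K] rounds left, at a slack above
    [2K - 1].  Rounding up a minimum cover adds at most [K] to its size, so it
    fits in the rest of the block and is played entirely, and it covers every
    deficit.  Minimum covers form a nonempty compact set, in which the
    lexicographically first one exists. *)

Require Import Defs.
From HB Require Import structures.
From mathcomp Require Import all_boot all_order all_algebra.
From mathcomp Require Import all_classical all_reals all_analysis.
From mathcomp Require Import lra.

Set Implicit Arguments.
Unset Strict Implicit.
Unset Printing Implicit Defensive.

Import Order.TTheory GRing.Theory Num.Theory.
Import numFieldNormedType.Exports.

Local Open Scope ring_scope.

(** * Existence and monotonicity of minimum fractional covers *)

Section MinimumCovers.
Local Open Scope classical_set_scope.
Variables (R : realType) (K : nat) (G : {set {set 'I_K}}).
Implicit Types (d : {set 'I_K} -> R) (y z : 'rV[R]_K) (P : set 'rV[R]_K).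

Lemma closed_ge_sum (a : pred 'I_K) (x : R) :
  closed [set y : 'rV[R]_K | x <= \sum_(i | a i) y 0 i].
Proof.
apply: (@closed_comp _ _ (fun y : 'rV[R]_K => \sum_(i | a i) y 0 i)
  [set s | x <= s]) => [y _|]; last exact: closed_ge.
by apply: (continuous_big add_continuous) => i _; exact: coord_continuous.
Qed.

Lemma closed_le_sum (a : pred 'I_K) (x : R) :
  closed [set y : 'rV[R]_K | \sum_(i | a i) y 0 i <= x].
Proof.
apply: (@closed_comp _ _ (fun y : 'rV[R]_K => \sum_(i | a i) y 0 i)
  [set s | s <= x]) => [y _|]; last exact: closed_le.
by apply: (continuous_big add_continuous) => i _; exact: coord_continuous.
Qed.

(** A nonnegative vector of total at most [M] has all coordinates in [[0, M]], so this is a closed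
    part of a compact box. *)
Lemma compact_bounded_covers d (M : R) :
  compact [set y | fractional_cover G d y /\ Defs.total y <= M].
Proof.
have cbox := @rV_compact R K (fun=> `[0, M]) (fun=> @segment_compact R 0 M).
have closedG : closed (\bigcap_(g in [set g | g \in G])
    [set y : 'rV[R]_K | d g <= \sum_(i in g) y 0 i]).
  by apply: closed_bigI => g _; exact: closed_ge_sum.
have closedM := @closed_le_sum xpredT M.
suff -> : [set y | fractional_cover G d y /\ Defs.total y <= M] =
    [set y : 'rV[R]_K | forall i, `[0, M] (y ord0 i)] `&`
    (\bigcap_(g in [set g | g \in G])
       [set y : 'rV[R]_K | d g <= \sum_(i in g) y 0 i] `&`
     [set y : 'rV[R]_K | \sum_i y 0 i <= M]).
  by apply: compact_closedI => //; exact: closedI.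
apply/seteqP; split=> y /=.
  move=> [[y0 yd] yM]; split; last by split.
  move=> i; rewrite /= in_itv /= y0 /=; apply: le_trans yM.
  by rewrite /Defs.total (bigD1 i) //= lerDl sumr_ge0.
by move=> [yb [yd yM]]; split=> //; split=> // i; have := yb i;
  rewrite /= in_itv /= => /andP[].
Qed.

(* Minimize the coordinates one after the other: the minimizers of each
   coordinate over the previous set form a nonempty compact set again. *)
Lemma lex_first_in P : P !=set0 -> compact P -> P (lex_first P).
Proof.
move=> P0 cP.
suff: exists y, P y /\ forall z, P z -> lex_le y z by move/(xgetPex 0) => -[].
(* [Q] collects the points of [P] that are lexicographically least on the first [m] coordinates. In
   the first alternative [k] is where [y] and [z] first differ, in the [?= iff] form of
   [lexi_tupleP]. *)
have lexm m : (m <= K)%N -> exists Q : set 'rV[R]_K,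
  [/\ Q !=set0, compact Q, Q `<=` P & forall y z, Q y -> P z ->
    (exists2 k : 'I_K, (k < m)%N &
       forall i : 'I_K, (i <= k)%N -> y 0 i <= z 0 i ?= iff (i != k)) \/
    (Q z /\ forall i : 'I_K, (i < m)%N -> y 0 i = z 0 i)].
  elim: m => [_|m IHm mK].
    by exists P; split=> // y z Py Pz; right.
  have [Q [Q0 cQ QP Qlex]] := IHm (ltnW mK).
  pose o := Ordinal mK.
  have co : continuous (fun y : 'rV[R]_K => y 0 o) by exact: coord_continuous.
  have [c /set_mem Qc cmin] :=
    compact_EVT_min Q0 cQ (continuous_subspaceT co).
  exists (Q `&` [set y | y 0 o <= c 0 o]); split.
  - by exists c; split=> /=.
  - apply: compact_closedI => //.
    apply: (@closed_comp _ _ (fun y : 'rV[R]_K => y 0 o)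
      [set s | s <= c 0 o]) => [y _|]; [exact: co | exact: closed_le].
  - by move=> y [/QP].
  move=> y z [Qy /= yc] Pz.
  have [[k km kP]|[Qz yz]] := Qlex y z Qy Pz.
    by left; exists k => //; exact: ltnW.
  have cz : c 0 o <= z 0 o by apply: cmin; exact/mem_set.
  have [ltyz|leyz] := ltP (y 0 o) (z 0 o).
    left; exists o => // i; rewrite leq_eqVlt => /orP[/eqP/val_inj ->|im].
      by split; [exact: ltW | rewrite eqxx lt_eqF].
    have -> : i != o by rewrite -val_eqE ltn_eqF.
    by rewrite yz //; split; rewrite ?eqxx.
  right; split; first by split=> //=; exact: le_trans yc.
  move=> i; rewrite ltnS leq_eqVlt => /orP[/eqP im|]; last exact: yz.
  have -> : i = o by exact: val_inj.
  by apply/eqP; rewrite eq_le leyz (le_trans yc).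
have [Q [[y Qy] _ QP QK]] := lexm K (leqnn K).
exists y; split=> [|z Pz]; first exact: QP.
apply/Order.TupleLexiOrder.lexi_tupleP.
have [[k _ kP]|[_ yz]] := QK y z Qy Pz.
  by exists (widen_ord (leqnSn K) k) => i ik; rewrite !tnth_mktuple; exact: kP.
(* The index [K], beyond every coordinate, encodes equality of the two tuples. *)
exists ord_max => i _; rewrite !tnth_mktuple yz //.
by split; rewrite ?lexx // eqxx neq_ltn ltn_ord.
Qed.

Hypothesis G_nonempty : forall g, g \in G -> g != finset.set0.

(** Each group contains an arm, and the constant is so large that this one arm already meets the
    group's demand. *)
Lemma fractional_cover_exists d : fractional_cover G d !=set0.
Proof.
exists (const_mx (\sum_(g in G) `|d g|)); split=> [i|g gG].
  by rewrite mxE sumr_ge0.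
have [j jg] := set0Pn _ (G_nonempty gG).
rewrite (bigD1 j) //= mxE (le_trans (ler_norm _)) //.
rewrite (bigD1 g) //= -addrA lerDl addr_ge0 ?sumr_ge0 // => i _.
by rewrite mxE addr_ge0 ?sumr_ge0.
Qed.

Lemma total_ge0 d y : fractional_cover G d y -> 0 <= Defs.total y.
Proof. by move=> [y0 _]; exact: sumr_ge0. Qed.

Lemma mc_le_total d y : fractional_cover G d y -> mc G d <= Defs.total y.
Proof.
move=> dy; apply: ge_inf; last by exists y.
by exists 0 => _ [z /total_ge0 z0 <-].
Qed.

Lemma mc_ge0 d : 0 <= mc G d.
Proof.
apply: lb_le_inf; last by move=> _ [y /total_ge0 y0 <-].
by have [y dy] := fractional_cover_exists d; exists (Defs.total y), y.
Qed.

(** Covers no larger than a fixed cover [z] form a compact set; a minimizer there also beats the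
    covers of larger total. *)
Lemma minimum_cover_exists d : minimum_cover G d !=set0.
Proof.
have [z dz] := fractional_cover_exists d.
have ct : continuous (@Defs.total R K).
  by apply: (continuous_big add_continuous) => i _; exact: coord_continuous.
have ne :
    [set y | fractional_cover G d y /\ Defs.total y <= Defs.total z] !=set0.
  by exists z.
have [c /set_mem /= [dc cz] cmin] := compact_EVT_min ne
  (@compact_bounded_covers d (Defs.total z)) (continuous_subspaceT ct).
exists c; split=> //; apply/eqP; rewrite eq_le mc_le_total // andbT.
apply: lb_le_inf; first by exists (Defs.total c), c.
move=> _ [y dy <-]; have [yz|zy] := leP (Defs.total y) (Defs.total z).
  by apply: cmin; exact/mem_set.
exact/(le_trans cz)/ltW.
Qed.

(** Ensures that the committed cover is a genuine minimum cover and not the default value of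
    [lex_first]. *)
Lemma lex_first_minimum_cover d :
  minimum_cover G d (lex_first (minimum_cover G d)).
Proof.
apply: lex_first_in; first exact: minimum_cover_exists.
have -> : minimum_cover G d =
    [set y | fractional_cover G d y /\ Defs.total y <= mc G d].
  apply/seteqP; split=> y /= [dy ty]; split=> //; first by rewrite ty.
  by apply/eqP; rewrite eq_le ty mc_le_total.
exact: compact_bounded_covers.
Qed.

Lemma mc_le d1 d2 : (forall g, d1 g <= d2 g) -> mc G d1 <= mc G d2.
Proof.
move=> d12; have [y [[y0 yd] <-]] := minimum_cover_exists d2.
by apply: mc_le_total; split=> // g gG; apply: le_trans (yd g gG).
Qed.

(* Adding one unit of arm a to a cover of d2 covers d1. *)
Lemma mc_le_pull d1 d2 (a : 'I_K) :
  (forall g, d1 g <= d2 g + (a \in g)%:R) -> mc G d1 <= mc G d2 + 1.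
Proof.
move=> d12; have [y [[y0 yd] <-]] := minimum_cover_exists d2.
pose z : 'rV[R]_K := \row_i (y 0 i + (i == a)%:R).
(* A general [p] serves both the group constraints and, at [xpredT], the total. *)
have sumz (p : pred 'I_K) : \sum_(i | p i) z 0 i =
    \sum_(i | p i) y 0 i + (p a)%:R.
  under eq_bigr do rewrite mxE; rewrite big_split /=; congr (_ + _).
  rewrite -natr_sum -big_mkcondr /=; congr (_%:R).
  have [pa|pa] := boolP (p a).
    by rewrite (bigD1 a) ?pa ?eqxx //= big1 // => i /andP[/andP[_ ->]].
  by rewrite big1 // => i /andP[pi /eqP ia]; rewrite ia (negbTE pa) in pi.
rewrite -[1]/((xpredT a)%:R) -sumz; apply: mc_le_total; split=> [i|g gG].
  by rewrite mxE addr_ge0 // ler0n.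
by rewrite sumz (le_trans (d12 g)) // lerD2r yd.
Qed.

End MinimumCovers.

(** * Playing out integer quotas of pulls *)

Section Commitment.
Variables (K : nat) (arm : nat -> 'I_K) (c n : nat).

Definition pulls_since (h : nat) (i : 'I_K) : nat :=
  (\sum_(c <= j < h) (arm j == i))%N.

(** Every round is credited to exactly one arm, so exchanging the two sums counts it once or not at
    all. *)
Lemma sum_pulls_since (h : nat) (p : pred 'I_K) :
  (\sum_(i | p i) pulls_since h i = \sum_(c <= j < h) p (arm j))%N.
Proof.
rewrite exchange_big /=; apply: eq_bigr => j _.
rewrite -big_mkcondr /=; have [pj|pj] := boolP (p (arm j)).
  by rewrite (bigD1 (arm j)) ?pj ?eqxx //= big1 // => i
    /andP[/andP[_ /eqP ->]]; rewrite eqxx.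
by rewrite big1 // => i /andP[pi /eqP ij]; rewrite ij pi in pj.
Qed.

Lemma pulls_sinceS (h : nat) (i : 'I_K) :
  (c <= h)%N -> pulls_since h.+1 i = (pulls_since h i + (arm h == i))%N.
Proof. by move=> ch; rewrite /pulls_since big_nat_recr. Qed.

(* If w is not exhausted at n, then every pull since c went to an arm below its
   quota, so no quota is exceeded and there were fewer than \sum_i w i pulls. *)
Lemma pulls_since_exhaust (w : 'I_K -> int) :
  (c <= n)%N -> (forall i, 0 <= w i) -> \sum_i w i <= (n - c)%N%:Z ->
  (forall h, (c <= h < n)%N -> (exists i, (pulls_since h i)%:Z < w i) ->
     (pulls_since h (arm h))%:Z < w (arm h)) ->
  forall i, w i <= (pulls_since n i)%:Z.
Proof.
move=> cn w0 wn play i; have [//|iw] := leP.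
have le_w m : (c + m <= n)%N -> forall k, (pulls_since (c + m) k)%:Z <= w k.
  elim: m => [|m IHm] mn k; first by rewrite addn0 /pulls_since big_geq.
  rewrite addnS in mn *; rewrite pulls_sinceS ?leq_addr //.
  have := IHm (ltnW mn) k; have [<- _|_] := eqVneq (arm (c + m)) k;
    last by rewrite addn0.
  rewrite PoszD lezD1; apply: play; first by rewrite leq_addr.
  (* Counts only grow, so [i], below its quota at [n], was below it at each earlier round. *)
  exists i; apply: le_lt_trans iw; rewrite lez_nat /pulls_since.
  by rewrite (big_cat_nat (n := (c + m)%N) (p := n)) ?leq_addr //= ltnW.
have : \sum_k (pulls_since n k)%:Z < \sum_k w k.
  rewrite (bigD1 i) //= [ltRHS](bigD1 i) //= ltr_leD // ler_sum // => k _.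
  by have := le_w (n - c)%N; rewrite subnKC //; apply.
move/lt_le_trans/(_ wn); rewrite -(big_morph Posz PoszD (erefl _)).
by rewrite (sum_pulls_since n xpredT) /= sum_nat_const_nat muln1 ltxx.
Qed.

End Commitment.

(** * Slack, guard and commitment within one block *)

Section Block.
Variables (R : realType) (K B : nat) (H : nat -> nat).
Variables (G : {set {set 'I_K}}) (f : nat -> {set 'I_K} -> nat) (eta : R).
Variables (A : nat -> 'I_K) (X : nat -> 'I_K -> R).
Hypothesis G_nonempty : forall g, g \in G -> g != finset.set0.

Let deficit := deficit R H f A.
Let slack := slack R H G f A.
Let rounded_cover := rounded_cover R H G f A.
Let committed_cover := committed_cover R H G f A.

Lemma group_pullsS b h g :
  group_pulls H A b h.+1 g = (group_pulls H A b h g + (arm_at H A b h \in g))%N.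
Proof. by rewrite /group_pulls big_ord_recr. Qed.

Lemma deficitS_le b h g : deficit b h.+1 g <= deficit b h g.
Proof. by rewrite ler_nat group_pullsS leq_sub2l // leq_addr. Qed.

Lemma deficit_leS b h g :
  deficit b h g <= deficit b h.+1 g + (arm_at H A b h \in g)%:R.
Proof.
rewrite -natrD ler_nat group_pullsS subnDA addnC.
by rewrite -leq_subLR.
Qed.

Lemma mc_pull b h :
  mc G (deficit b h) <= mc G (deficit b h.+1) + 1.
Proof. exact/mc_le_pull/deficit_leS. Qed.

(** One round is used up, while [mc] does not rise because no deficit does. *)
Lemma slack_step b h : (h < H b)%N -> slack b h - 1 <= slack b h.+1.
Proof.
move=> hH; rewrite /slack /Defs.slack /remaining.
have -> : (H b - h)%N = (H b - h.+1).+1 by rewrite subnSK.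
have := mc_le G_nonempty (deficitS_le b h).
by rewrite -natr1 /deficit; lra.
Qed.

Lemma slack_le_remaining b h : slack b h <= (remaining H b h)%:R.
Proof. by rewrite gerBl mc_ge0. Qed.

Lemma slack0 b : slack b 0 = (H b)%:R - mc G (fun g => (f b g)%:R : R).
Proof.
rewrite /slack /Defs.slack /remaining subn0; congr (_ - mc _ _).
by apply/funext => g; rewrite /Defs.deficit /group_pulls big_ord0 subn0.
Qed.

Lemma guard_fires b : (0 < K)%N -> (2 * K)%:R < slack b 0 ->
  exists c, [/\ guard_fires_at R H G f A b c, (2 * K <= remaining H b c)%N
              & (2 * K)%:R - 1 < slack b c].
Proof.
move=> K0 s0; have KH : (2 * K < H b)%N.
  by have := lt_le_trans s0 (slack_le_remaining b 0);
    rewrite ltr_nat /remaining subn0.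
have ex : exists c, slack b c <= (2 * K)%:R.
  (* Exactly [2 * K] rounds remain at this position. *)
  exists (H b - 2 * K)%N; apply: le_trans (slack_le_remaining _ _) _.
  by rewrite /remaining subKn // ltnW.
have [c sc cmin] := ex_minnP ex.
have cH : (c <= H b - 2 * K)%N.
  apply: cmin; apply: le_trans (slack_le_remaining _ _) _.
  by rewrite /remaining subKn // ltnW.
have before h : (h < c)%N -> (2 * K)%:R < slack b h.
  by rewrite ltnNge ltNge; apply: contra => /cmin.
have KcH : (2 * K + c <= H b)%N by rewrite -leq_subRL // ltnW.
have ltcH : (c < H b)%N.
  by apply: leq_trans KcH; rewrite -add1n leq_add2r muln_gt0.
exists c; split; first by split.
  by rewrite /remaining leq_subRL ?(ltnW ltcH) // addnC.
(* The slack at position 0 exceeds the threshold, so [c] has a predecessor, where by minimality the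
   slack is still above [2 * K]. *)
have c0 : (0 < c)%N.
  by case: posnP => // c0; move: s0; rewrite ltNge; move: sc; rewrite c0 => ->.
rewrite -(prednK c0); apply: lt_le_trans (slack_step _).
  by rewrite ltrD2r before // ltn_predL.
exact: leq_ltn_trans (leq_pred _) ltcH.
Qed.

Lemma committed_cover_min b c :
  minimum_cover G (deficit b c) (committed_cover b c).
Proof. exact: lex_first_minimum_cover. Qed.

Lemma rounded_cover_ge0 b c i : 0 <= rounded_cover b c i.
Proof.
rewrite ceil_ge0; have [[+ _] _] := committed_cover_min b c.
by move/(_ i); apply: lt_le_trans; rewrite ltrN10.
Qed.

Lemma rounded_cover_size b c :
  (\sum_i rounded_cover b c i)%:~R <= mc G (deficit b c) + K%:R :> R.
Proof.
have [_ <-] := committed_cover_min b c.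
rewrite raddf_sum /= -[in K%:R](card_ord K) -sum1_card natr_sum -big_split /=.
apply: ler_sum => i _; have := ceilB1_lt (committed_cover b c 0 i).
by rewrite intrB ltrBlDr => /ltW.
Qed.

Lemma rounded_cover_deficit b c g : g \in G ->
  deficit b c g <= (\sum_(i in g) rounded_cover b c i)%:~R.
Proof.
move=> gG; have [[_ /(_ g gG) dg] _] := committed_cover_min b c.
by rewrite raddf_sum (le_trans dg) //= ler_sum // => i _; exact: ceil_ge.
Qed.

Lemma floors_met b c : (b < B)%N -> pbdq_ucb_path B H G f eta A X ->
  guard_fires_at R H G f A b c ->
  (\sum_i rounded_cover b c i)%:~R <= (remaining H b c)%:R :> R ->
  forall g, g \in G -> (f b g <= group_pulls H A b (H b) g)%N.
Proof.
move=> bB path fire fits g gG; have [cH _ _] := fire.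
have exhaust := @pulls_since_exhaust K (arm_at H A b) c (H b)
  (rounded_cover b c) (ltnW cH) (rounded_cover_ge0 b c).
have {}exhaust i :
    rounded_cover b c i <= (pulls_since (arm_at H A b) c (H b) i)%:Z.
  apply: exhaust => [|h /andP[ch hH]]; first by rewrite -(ler_int R).
  (* [owed] unfolds to being below quota, so the path condition after the guard supplies the rule of
     play. *)
  by have [_ /(_ c ch fire) []] := path b h bB hH.
have : deficit b c g <= (\sum_(c <= j < H b) (arm_at H A b j \in g))%:R.
  apply: le_trans (rounded_cover_deficit b c gG) _.
  rewrite -(sum_pulls_since (arm_at H A b) c (H b) (mem g)).
  rewrite -[leRHS]/(_%:Z%:~R) ler_int (big_morph Posz PoszD (erefl _)).
  exact: ler_sum.
(* The pulls before [c] move to the right, where they join those since [c] to make up all pulls of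
   the block. *)
rewrite ler_nat leq_subLR; congr (_ <= _)%N.
pose in_g j : nat := arm_at H A b j \in g.
by rewrite /group_pulls -!(big_mkord xpredT in_g)
  [RHS](big_cat_nat (n := c)) // ltnW.
Qed.

End Block.

Theorem proposition26 (R : realType) (K B : nat) (H : nat -> nat)
    (G : {set {set 'I_K}}) (f : nat -> {set 'I_K} -> nat) (eta : R)
    (A : nat -> 'I_K) (X : nat -> 'I_K -> R)
    (G_nonempty : forall g, g \in G -> g != finset.set0)
    (eta01 : 0 < eta < 1)
    (X01 : forall t i, (t < horizon B H)%N -> 0 <= X t i <= 1)
    (initial_slack : forall b, (b < B)%N ->
       (2 * K)%:R < (H b)%:R - mc G (fun g => (f b g)%:R : R))
    (path : pbdq_ucb_path B H G f eta A X) :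
  forall b, (b < B)%N ->
    [/\ forall g, g \in G -> (f b g <= group_pulls H A b (H b) g)%N,
        forall h, (h < H b)%N ->
          mc G (deficit R H f A b h) - mc G (deficit R H f A b h.+1) <= 1
      & exists c,
          let d := deficit R H f A b c in
          let r := (remaining H b c)%:R : R in
          let size := (\sum_(i < K) rounded_cover R H G f A b c i)%:~R : R in
          guard_fires_at R H G f A b c /\
          (2 * K <= remaining H b c)%N /\
          (2 * K)%:R - 1 < slack R H G f A b c /\
          minimum_cover G d (committed_cover R H G f A b c) /\
          size <= mc G d + K%:R /\
          mc G d + K%:R <= r - K%:R + 1 /\
          size <= r].
Proof.
move=> b bB.
(* The arm [A 0] witnesses that there is at least one arm. *)
have K0 : (0 < K)%N by apply: leq_trans (ltn_ord (A 0)).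
have s0 : (2 * K)%:R < slack R H G f A b 0 by rewrite slack0 initial_slack.
have [c [fire rK sK]] := guard_fires G_nonempty K0 s0.
have size_le := @rounded_cover_size R K H G f A G_nonempty b c.
have mc_le_r : mc G (deficit R H f A b c) + K%:R
    <= (remaining H b c)%:R - K%:R + 1.
  by move: sK; rewrite /slack natrM; lra.
have fits : (\sum_i rounded_cover R H G f A b c i)%:~R
    <= (remaining H b c)%:R :> R.
  (* With [K] at least 1, the bound [r - K + 1] is at most [r]. *)
  by have : 1 <= K%:R :> R; [rewrite ler1n | lra].
split; first exact: floors_met path fire fits.
- by move=> h _; rewrite lerBlDl mc_pull.
- by exists c; do 3![split=> //]; split=> //; exact: committed_cover_min.
Qed.
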